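(* Let $n\ge 1$ be a fixed odd number and let $k\ge 0$ be an integer. Then for every $x=x_0+\underline{x}\in\mathbb{R}^{n+1}$, $$\Delta_{\mathbb{R}^{n+1}}^{\frac{n-1}{2}}\left(x^{n+k-1}\right)=\gamma_n\,\frac{(n+k-1)!}{k!}\,P_k^n(x),\qquad \gamma_n:=\frac{(-1)^{\frac{n-1}{2}}2^{n-1}}{(n-1)!}\left[\Gamma\left(\tfrac{n+1}{2}\right)\right]^2 .$$
   Context: $\mathbb{R}_n$ is the real Clifford algebra generated by $e_1,\dots,e_n$ with $e_\ell e_m+e_me_\ell=0$ for $\ell\ne m$ and $e_\ell^2=-1$. A point $(x_0,x_1,\dots,x_n)\in\mathbb{R}^{n+1}$ is identified with the paravector $x=x_0+\underline{x}$, $\underline{x}=\sum_{\ell=1}^n x_\ell e_\ell$, and $\bar x=x_0-\underline{x}$. Powers $x^j$ are taken in $\mathbb{R}_n$. $\Delta_{\mathbb{R}^{n+1}}=\sum_{i=0}^n\partial_{x_i}^2$ is the Laplacian in $n+1$ variables, acting on $\mathbb{R}_n$-valued functions, and $\Delta_{\mathbb{R}^{n+1}}^{(n-1)/2}$ is its $\frac{n-1}{2}$-th iterate. The Clifford-Appell polynomials are $$P_k^n(x):=\sum_{s=0}^k T_s^k(n)\,x^{k-s}\bar x^{s},\qquad T_s^k(n):=\binom{k}{s}\frac{\left(\frac{n+1}{2}\right)_{k-s}\left(\frac{n-1}{2}\right)_s}{(n)_k},$$ where $(a)_0=1$ and $(a)_s=a(a+1)\cdots(a+s-1)$ for $s>0$.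 *)

(* Defs.v *)
From HB Require Import structures.
From mathcomp Require Import all_boot all_order all_algebra.
From mathcomp Require Import all_classical all_reals all_analysis.
Import Order.TTheory GRing.Theory Num.Theory numFieldNormedType.Exports.

Set Implicit Arguments.
Unset Strict Implicit.
Unset Printing Implicit Defensive.

Local Open Scope ring_scope.

(* Coordinates of an element of the Clifford algebra are indexed by the subsets
   A of 'I_n through enum_rank; the coordinate at A is the coefficient of
   e_A = e_{a_1} ... e_{a_r}, where A = {a_1 < ... < a_r}. *)
Definition clifford (R : realType) (n : nat) : Type :=
  'rV[R]_#|{set 'I_n}|.

HB.instance Definition _ (R : realType) (n : nat) :=
  NormedModule.copy (clifford R n) 'rV[R]_#|{set 'I_n}|.

Section CliffordAlgebra.
Variables (R : realType) (n : nat).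
Implicit Types (A B C : {set 'I_n}) (u v w : clifford R n).

Definition cl_coef u A : R := (u : 'rV[R]_#|{set 'I_n}|) 0 (enum_rank A).

Definition cl_blade A : clifford R n := delta_mx 0 (enum_rank A).

Definition symdiff A B : {set 'I_n} := (A :\: B) :|: (B :\: A).

(* e_A e_B = (-1)^N e_{symdiff A B}, with N the number of pairs (a, b) in A x B
   with b <= a: sorting the word e_A e_B takes one transposition for each pair
   with b < a, and each common index contributes e_a ^ 2 = -1. *)
Definition cl_sign A B : bool :=
  odd #|[set p : 'I_n * 'I_n | [&& p.1 \in A, p.2 \in B & (p.2 <= p.1)%N]]|.

Definition cl_mul u v : clifford R n :=
  \sum_A \sum_B
    ((-1) ^+ cl_sign A B * (cl_coef u A * cl_coef v B)) *: cl_blade (symdiff A B).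

Lemma in_symdiff A B i : (i \in symdiff A B) = (i \in A) (+) (i \in B).
Proof. by rewrite !inE; case: (i \in A); case: (i \in B). Qed.

Lemma symdiffA : associative symdiff.
Proof. by move=> A B C; apply/finset.setP => i; rewrite !in_symdiff addbA. Qed.

Lemma symdiff0s : left_id finset.set0 symdiff.
Proof. by move=> A; apply/finset.setP => i; rewrite in_symdiff inE. Qed.

Lemma symdiffs0 : right_id finset.set0 symdiff.
Proof. by move=> A; apply/finset.setP => i; rewrite in_symdiff inE addbF. Qed.

Lemma cl_signE A B : cl_sign A B =
  \big[addb/false]_a \big[addb/false]_b
    [&& a \in A, b \in B & (b <= a)%N].
Proof.
rewrite /cl_sign -sum1_card big_mkcond /= (big_morph odd oddD (erefl _)).
rewrite pair_big /=; apply: eq_bigr => p _.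
by rewrite inE; case: ifP.
Qed.

Lemma cl_sign_symdiffl A B C :
  cl_sign (symdiff A B) C = cl_sign A C (+) cl_sign B C.
Proof.
rewrite !cl_signE -big_split /=; apply: eq_bigr => a _.
rewrite -big_split /=; apply: eq_bigr => b _.
rewrite in_symdiff.
by case: (a \in A); case: (a \in B); case: (b \in C); case: (_ <= _)%N.
Qed.

Lemma cl_sign_symdiffr A B C :
  cl_sign A (symdiff B C) = cl_sign A B (+) cl_sign A C.
Proof.
rewrite !cl_signE -big_split /=; apply: eq_bigr => a _.
rewrite -big_split /=; apply: eq_bigr => b _.
rewrite in_symdiff.
by case: (a \in A); case: (b \in B); case: (b \in C); case: (_ <= _)%N.
Qed.

Lemma cl_sign0s A : cl_sign finset.set0 A = false.
Proof. by rewrite cl_signE big1 // => a _; rewrite big1 // => b _; rewrite inE. Qed.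

Lemma cl_signs0 A : cl_sign A finset.set0 = false.
Proof.
by rewrite cl_signE big1 // => a _; rewrite big1 // => b _; rewrite inE andbF.
Qed.

Lemma cl_coefD u v A : cl_coef (u + v) A = cl_coef u A + cl_coef v A.
Proof. by rewrite /cl_coef mxE. Qed.

Lemma cl_coefZ (a : R) u A : cl_coef (a *: u) A = a * cl_coef u A.
Proof. by rewrite /cl_coef mxE. Qed.

Lemma cl_coef_blade A B : cl_coef (cl_blade A) B = (B == A)%:R.
Proof. by rewrite /cl_coef mxE eqxx /= (inj_eq enum_rank_inj). Qed.

Lemma cl_expand u : u = \sum_A cl_coef u A *: cl_blade A.
Proof.
rewrite {1}[u]row_sum_delta (reindex _ (onW_bij _ (@enum_rank_bij _))) /=.
by [].
Qed.

Lemma cl_mulDl : left_distributive cl_mul +%R.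
Proof.
move=> u v w; rewrite /cl_mul -big_split /=; apply: eq_bigr => A _.
rewrite -big_split /=; apply: eq_bigr => B _.
by rewrite -scalerDl cl_coefD mulrDl mulrDr.
Qed.

Lemma cl_mulDr : right_distributive cl_mul +%R.
Proof.
move=> u v w; rewrite /cl_mul -big_split /=; apply: eq_bigr => A _.
rewrite -big_split /=; apply: eq_bigr => B _.
by rewrite -scalerDl cl_coefD !mulrDr.
Qed.

Lemma cl_mulZl (a : R) u v : a *: cl_mul u v = cl_mul (a *: u) v.
Proof.
rewrite /cl_mul scaler_sumr; apply: eq_bigr => A _.
rewrite scaler_sumr; apply: eq_bigr => B _.
by rewrite scalerA cl_coefZ -(mulrA a) (mulrCA a).
Qed.

Lemma cl_mulZr (a : R) u v : a *: cl_mul u v = cl_mul u (a *: v).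
Proof.
rewrite /cl_mul scaler_sumr; apply: eq_bigr => A _.
rewrite scaler_sumr; apply: eq_bigr => B _.
by rewrite scalerA cl_coefZ (mulrCA a) (mulrCA a (cl_coef u A)).
Qed.

Lemma cl_mul_suml (I : finType) (F : I -> clifford R n) v :
  cl_mul (\sum_i F i) v = \sum_i cl_mul (F i) v.
Proof.
apply: (big_morph (cl_mul^~ v)) => [x y|]; first exact: cl_mulDl.
by have := cl_mulZl 0 0 v; rewrite !scale0r => <-.
Qed.

Lemma cl_mul_sumr (I : finType) (F : I -> clifford R n) v :
  cl_mul v (\sum_i F i) = \sum_i cl_mul v (F i).
Proof.
apply: (big_morph (cl_mul v)) => [x y|]; first exact: cl_mulDr.
by have := cl_mulZr 0 v 0; rewrite !scale0r => <-.
Qed.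

Lemma cl_mul_blade A B :
  cl_mul (cl_blade A) (cl_blade B) =
  (-1) ^+ cl_sign A B *: cl_blade (symdiff A B).
Proof.
rewrite /cl_mul (bigD1 A) //= [X in _ + X]big1 ?addr0; last first.
  move=> C /negPf CA; rewrite big1 // => D _.
  by rewrite cl_coef_blade CA mul0r mulr0 scale0r.
rewrite (bigD1 B) //= big1 ?addr0; last first.
  by move=> D /negPf DB; rewrite !cl_coef_blade DB !mulr0 scale0r.
by rewrite !cl_coef_blade !eqxx !mulr1.
Qed.

Lemma cl_mul_bladeA A B C :
  cl_mul (cl_blade A) (cl_mul (cl_blade B) (cl_blade C)) =
  cl_mul (cl_mul (cl_blade A) (cl_blade B)) (cl_blade C).
Proof.
rewrite [in LHS](cl_mul_blade B) [in RHS](cl_mul_blade A) -cl_mulZr -cl_mulZl.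
rewrite !cl_mul_blade !scalerA symdiffA; congr (_ *: _).
rewrite cl_sign_symdiffl cl_sign_symdiffr !signr_addb.
by rewrite mulrC -mulrA.
Qed.

Lemma cl_mulA : associative cl_mul.
Proof.
move: cl_mul_suml cl_mul_sumr cl_mulZl cl_mulZr cl_mul_bladeA.
move: cl_mul => m suml sumr Zl Zr mA u v w.
rewrite (cl_expand u) !suml; apply: eq_bigr => A _.
rewrite (cl_expand v) suml !sumr suml; apply: eq_bigr => B _.
rewrite (cl_expand w) !sumr; apply: eq_bigr => C _.
do 3! rewrite -?Zl -?Zr.
by rewrite mA; congr (_ *: _); rewrite !scalerA mulrC.
Qed.

Lemma cl_mul1 : left_id (cl_blade finset.set0) cl_mul.
Proof.
move=> u; rewrite [u]cl_expand cl_mul_sumr; apply: eq_bigr => A _.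
by rewrite -cl_mulZr cl_mul_blade cl_sign0s scale1r symdiff0s.
Qed.

Lemma cl_mulr1 : right_id (cl_blade finset.set0) cl_mul.
Proof.
move=> u; rewrite [u]cl_expand cl_mul_suml; apply: eq_bigr => A _.
by rewrite -cl_mulZl cl_mul_blade cl_signs0 scale1r symdiffs0.
Qed.

Lemma cl_one_neq0 : cl_blade finset.set0 != 0.
Proof.
apply/eqP => /(congr1 (cl_coef^~ finset.set0)).
rewrite cl_coef_blade eqxx /cl_coef mxE => /eqP.
by rewrite oner_eq0.
Qed.

HB.instance Definition _ := GRing.Zmodule_isNzRing.Build (clifford R n)
  cl_mulA cl_mul1 cl_mulr1 cl_mulDl cl_mulDr cl_one_neq0.
HB.instance Definition _ :=
  GRing.Lmodule_isLalgebra.Build R (clifford R n) cl_mulZl.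
HB.instance Definition _ :=
  GRing.Lalgebra_isAlgebra.Build R (clifford R n) cl_mulZr.

Definition cl_gen (l : 'I_n) : clifford R n := cl_blade [set l].

Lemma cl_mulE A B : cl_blade A * cl_blade B =
  (-1) ^+ cl_sign A B *: cl_blade (symdiff A B).
Proof. exact: cl_mul_blade. Qed.

Lemma cl_sign_set1 (i : 'I_n) B :
  cl_sign [set i] B = \big[addb/false]_b ((b \in B) && (b <= i)%N).
Proof.
rewrite cl_signE (bigD1 i) //= [X in _ (+) X]big1 ?addbF; last first.
  by move=> a /negPf ai; rewrite big1 // => b _; rewrite !inE ai.
by apply: eq_bigr => b _; rewrite inE eqxx.
Qed.

Lemma cl_sign_set11 (i j : 'I_n) : cl_sign [set i] [set j] = (j <= i)%N.
Proof.
rewrite cl_sign_set1 (bigD1 j) //= [X in _ (+) X]big1 ?addbF ?inE ?eqxx //.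
by move=> b /negPf bj; rewrite !inE bj.
Qed.

Lemma cl_gen_sqr (l : 'I_n) : cl_gen l ^+ 2 = -1.
Proof.
rewrite expr2 cl_mulE cl_sign_set11 leqnn.
have -> : symdiff [set l] [set l] = finset.set0.
  by apply/finset.setP => i; rewrite in_symdiff !inE addbb.
by rewrite scaleN1r.
Qed.

Lemma cl_gen_anticomm (l m : 'I_n) : l != m ->
  cl_gen l * cl_gen m + cl_gen m * cl_gen l = 0.
Proof.
move=> lm; rewrite !cl_mulE !cl_sign_set11.
rewrite (_ : symdiff [set m] [set l] = symdiff [set l] [set m]); last first.
  by apply/finset.setP => i; rewrite !in_symdiff addbC.
rewrite -scalerDl; move: lm; rewrite -val_eqE /=.
by case: ltngtP => // _ _; rewrite expr0 expr1 (addrN, addNr) scale0r.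
Qed.

(* The product runs over A in increasing order. *)
Lemma cl_blade_prod A : cl_blade A = \prod_(l <- enum A) cl_gen l.
Proof.
have: sorted (relpre val ltn) (enum A).
  rewrite /enum_mem; apply: sorted_filter; first by move=> x y z; exact: ltn_trans.
  by rewrite -enumT -sorted_map val_enum_ord iota_ltn_sorted.
rewrite -[in cl_blade A](finset.set_enum A); elim: (enum A) => [_|a s IHs /= sa].
  by rewrite big_nil; congr cl_blade; apply/finset.setP => i; rewrite !inE.
rewrite big_cons -IHs ?(path_sorted sa)// cl_mulE.
have lt_a b : b \in s -> (a < b)%N.
  move: sa; rewrite path_sortedE => [/andP[/allP sa _] /sa //|].
  by move=> x y z; exact: ltn_trans.
rewrite cl_sign_set1 big1 ?expr0 ?scale1r => [|b _]; last first.
  by rewrite inE; apply/andP => -[/lt_a]; rewrite ltnNge => /negP.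
congr cl_blade; apply/finset.setP => i; rewrite in_symdiff !inE.
by case: eqVneq => //= ->; case: (boolP (a \in s)) => // /lt_a; rewrite ltnn.
Qed.

End CliffordAlgebra.

Definition paravector (R : realType) (n : nat) (x : 'rV[R]_n.+1) :
    clifford R n :=
  (x 0 0)%:A + \sum_(l < n) x 0 (lift ord0 l) *: cl_gen R l.

Definition paravector_conj (R : realType) (n : nat) (x : 'rV[R]_n.+1) :
    clifford R n :=
  (x 0 0)%:A - \sum_(l < n) x 0 (lift ord0 l) *: cl_gen R l.

Definition laplacian (R : realType) (n : nat) (V : normedModType R)
    (f : 'rV[R]_n.+1 -> V) : 'rV[R]_n.+1 -> V :=
  fun x => \sum_(i < n.+1) 'D_(delta_mx 0 i) ('D_(delta_mx 0 i) f) x.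

Definition pochhammer (R : realType) (a : R) (s : nat) : R :=
  \prod_(i < s) (a + i%:R).

Definition appell_coef (R : realType) (n k s : nat) : R :=
  'C(k, s)%:R *
  (pochhammer (n.+1%:R / 2) (k - s) * pochhammer ((n%:R - 1) / 2) s
   / pochhammer n%:R k).

Definition appell (R : realType) (n k : nat) (x : 'rV[R]_n.+1) :
    clifford R n :=
  \sum_(s < k.+1)
    appell_coef R n k s *: (paravector x ^+ (k - s) * paravector_conj x ^+ s).

Definition Gamma (R : realType) (a : R) : R :=
  \int[lebesgue_measure]_(t in `]0, +oo[) (t `^ (a - 1) * expR (- t)).

Definition gamma_coef (R : realType) (n : nat) : R :=
  (-1) ^+ ((n - 1) %/ 2) * 2 ^+ (n - 1) / (n - 1)`!%:R
  * Gamma (n.+1%:R / 2) ^+ 2.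

(* Main.v *)
(* Write m = (n - 1) / 2 and let q = 1 - 2 x_0 t + |x|^2 t^2 = (1 - x t)(1 - \bar x t),
   so that (1 - x t)^-1 = (1 - \bar x t) q^-1 is the generating series of the
   powers of x. From grad q = 2 t (t x - e_0) and |grad q|^2 = 4 t^2 q one gets
     Laplacian ((1 - \bar x t) q^-a) = 4 a (a - m - 1) t^2 (1 - \bar x t) q^-(a+1).
   After m steps the series is a multiple of
     t^(2m) (1 - \bar x t) q^-(m+1) = t^(2m) (1 - x t)^-(m+1) (1 - \bar x t)^-m,
   and the binomial series of the two factors gives the coefficients T_s^k(n). *)
Require Import Defs.
From mathcomp Require Import all_boot all_order all_algebra.
From mathcomp Require Import all_classical all_reals all_analysis.
From mathcomp Require Import measurable_realfun ring zify.
Import Order.TTheory GRing.Theory Num.Theory numFieldNormedType.Exports.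

Set Implicit Arguments.
Unset Strict Implicit.
Unset Printing Implicit Defensive.

Local Open Scope ring_scope.

(** * The Gamma function at positive integers *)

Section GammaFactorial.
Local Open Scope classical_set_scope.
Variable R : realType.

(** Since [expR t] is at least t^(m+1)/(m+1)!, the function is bounded by (m+1)!/t for t > 0. *)
Lemma cvg_exprMexpRN m : (t : R) ^+ m * expR (- t) @[t --> +oo] --> (0 : R).
Proof.
apply/cvgrPdist_le => /= e e0.
near=> t.
have t0 : 0 < t by near: t; exact: nbhs_pinfty_gt.
have ht : (m.+1)`!%:R / e <= t by near: t; apply: nbhs_pinfty_ge; rewrite num_real.
rewrite sub0r normrN ger0_norm; last by rewrite mulr_ge0 ?expR_ge0 ?exprn_ge0 ?ltW.
rewrite expRN ler_pdivrMr ?expR_gt0 //.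
have := expR_ge1Dxn m (ltW t0).
have f0 : 0 < (m.+1)`!%:R :> R by rewrite ltr0n fact_gt0.
move=> h.
have h1 : t ^+ m.+1 / (m.+1)`!%:R <= expR t.
  by apply: le_trans h; rewrite lerDr.
apply: le_trans (_ : e * (t ^+ m.+1 / (m.+1)`!%:R) <= _); last by rewrite ler_pM2l.
rewrite mulrA ler_pdivlMr // exprS mulrA mulrC ler_pM2r ?exprn_gt0 //.
by rewrite mulrC -ler_pdivrMr.
Unshelve. all: by end_near.
Qed.

Lemma is_derive_exprMexpRN m (t : R) : is_derive t 1
  (fun t => t ^+ m.+1 * expR (- t)) ((m.+1%:R * t ^+ m - t ^+ m.+1) * expR (- t)).
Proof.
have h1 : is_derive t 1 (fun t => expR (- t)) (- expR (- t)).
  have h := @is_derive1_comp R expR -%R t _ _ (is_derive_expR _) (is_deriveNid _ _).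
  by apply: (is_derive_eq h); rewrite mulrN1.
have h2 := is_deriveX m.+1 (is_derive_id t (1 : R)).
rewrite (_ : (fun t => _) = id ^+ m.+1 * (fun t : R => expR (- t))); last first.
  by apply/funext => s; rewrite /GRing.mul /= exprfctE.
apply: (is_derive_eq (is_deriveM h2 h1)).
rewrite exprfctE /GRing.scale /=; ring.
Qed.

(** As F vanishes at infinity, the integral of t^m exp(-t) over the positive half-line is
    [- F 0]. *)
Lemma exprMexpRN_antiderivative m : exists F : R -> R,
  [/\ forall t : R, is_derive t (1 : R) F (t ^+ m * expR (- t)),
      F t @[t --> +oo] --> (0 : R) & F 0 = - m`!%:R].
Proof.
elim: m => [|m [F [dF F0 FE]]].
  exists (fun t => - expR (- t)); split.
  - move=> t.
    have h := @is_derive1_comp R expR -%R t _ _ (is_derive_expR _) (is_deriveNid _ _).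
    by apply: (is_derive_eq (is_deriveN h)); rewrite mulrN1 opprK mul1r.
  - by rewrite -oppr0; apply: cvgN; exact: cvgr_expR.
  - by rewrite oppr0 expR0.
(* Integration by parts. *)
exists (fun t => m.+1%:R * F t - t ^+ m.+1 * expR (- t)); split.
- move=> t.
  have h := is_deriveB (is_deriveZ m.+1%:R (dF t)) (is_derive_exprMexpRN m t).
  by apply: (is_derive_eq h); rewrite /GRing.scale /=; ring.
- rewrite (_ : 0 = m.+1%:R * 0 - 0 :> R); last by rewrite mulr0 subrr.
  by apply: cvgB; [exact: cvgMl_tmp | exact: cvg_exprMexpRN].
- by rewrite FE expr0n mul0r subr0 factS natrM mulrN.
Qed.

Lemma Gamma_succ m : Gamma (m.+1%:R : R) = m`!%:R.
Proof.
have [F [dF Fy F0]] := exprMexpRN_antiderivative m.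
rewrite /Gamma.
pose f (t : R) := t ^+ m * expR (- t).
have cf : continuous f.
  move=> t; apply: cvgM; first exact: exprn_continuous.
  by apply: continuous_comp; [exact: opp_continuous | exact: continuous_expR].
have cF : continuous F.
  by move=> t; apply/differentiable_continuous/derivable1_diffP; case: (dF t).
have f_ge0 t : 0 <= t -> 0 <= f t.
  by move=> t0; rewrite mulr_ge0 ?exprn_ge0 ?expR_ge0.
have FTC : (\int[lebesgue_measure]_(t in `[0%R, +oo[) (f t)%:E = 0%:E - (F 0)%:E)%E.
  apply: ge0_continuous_FTC2y => //.
  - exact: continuous_subspaceT.
  - by apply: cvg_at_right_filter; exact: cF.
  - by move=> t _; rewrite derive1E; case: (dF t).
transitivity (\int[lebesgue_measure]_(t in `]0, +oo[) f t).
  apply: eq_Rintegral => t; rewrite inE /= in_itv /= andbT => t0.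
  by rewrite -[m.+1%:R]natr1 addrK powR_mulrn ?ltW.
rewrite /Rintegral integral_itv_obnd_cbnd; last first.
  apply/measurable_EFinP/measurable_funTS; exact: continuous_measurable_fun.
by rewrite FTC F0 /= sub0r opprK.
Qed.

End GammaFactorial.

(** * Coefficients of negative powers of a quadratic *)

(* The coefficient of t^(k-1) in (1 - 2 p t + q t^2)^-a. The value 0 at k = 0
   makes the recurrences below hold for every k with truncated k.-1 and k.-2. *)
Fixpoint gegenbauer (K : comNzRingType) (p q : K) (a : nat) : nat -> K :=
  if a is b.+1 then
    fix g k := if k is k1.+1 then
      gegenbauer p q b k + 2 * p * g k1 - q * (if k1 is k2.+1 then g k2 else 0)
    else 0
  else fun k => (k == 1)%:R.

Arguments gegenbauer : simpl never.

Section Gegenbauer.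
Variables (K : comNzRingType) (p q : K).

Lemma gegenbauer_0 a : gegenbauer p q a 0 = 0.
Proof. by case: a. Qed.

Lemma gegenbauerS a k : gegenbauer p q a.+1 k.+1 =
  gegenbauer p q a k.+1 + 2 * p * gegenbauer p q a.+1 k
  - q * gegenbauer p q a.+1 k.-1.
Proof. by case: k. Qed.

Lemma gegenbauer_rec a k : gegenbauer p q a k =
  gegenbauer p q a.+1 k - 2 * p * gegenbauer p q a.+1 k.-1
  + q * gegenbauer p q a.+1 k.-2.
Proof.
by case: k => [|k]; [rewrite !gegenbauer_0; ring | rewrite gegenbauerS; ring].
Qed.

End Gegenbauer.

(** * Partial derivatives and Laplacians of the coefficients *)

Section Laplacian.
Local Open Scope classical_set_scope.
Variables (R : realType) (n : nat).
Implicit Types (x y v : 'rV[R]_n.+1).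

Lemma is_derive_coord x v i : is_derive x v (fun y => y 0 i) (v 0 i).
Proof.
have hid : derivable (@id 'rV[R]_n.+1) x v by exact: derivable_id.
apply: DeriveDef; first by move/derivable_mxP : hid; exact.
have := derive_mx hid.
by rewrite derive_id => /matrixP/(_ 0 i); rewrite mxE.
Qed.

Lemma is_derive_subM x v (c : R) (f g : 'rV[R]_n.+1 -> R) i (df dg : R) :
  is_derive x v f df -> is_derive x v g dg ->
  is_derive x v (fun y => c * f y - y 0 i * g y)
    (c * df - (v 0 i * g x + x 0 i * dg)).
Proof.
move=> hf hg; have hi := is_derive_coord x v i.
have h := is_deriveB (is_deriveZ c hf) (is_deriveM hi hg).
by apply: (is_derive_eq h); rewrite /GRing.scale /=; ring.
Qed.

Lemma is_derive_scalel (V : normedModType R) x v (f : 'rV[R]_n.+1 -> R) (df : R) (c : V) :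
  is_derive x v f df -> is_derive x v (fun y => f y *: c) (df *: c).
Proof.
move=> [dfx dfE].
suff H : (fun h : R => h^-1 *: (((fun y => f y *: c) \o shift x) (h *: v) - f x *: c)) @ 0^'
    --> df *: c.
  by apply: DeriveDef; [apply/cvg_ex; exists (df *: c) | exact: cvg_lim H].
under eq_fun do rewrite /= -scalerBl scalerA.
by apply: cvgZr_tmp; rewrite -dfE.
Qed.

Lemma is_derive_sumZ (V : normedModType R) N x v (g : 'I_N -> 'rV[R]_n.+1 -> R)
    (dg : 'I_N -> R) (c : 'I_N -> V) :
  (forall j, is_derive x v (g j) (dg j)) ->
  is_derive x v (fun y => \sum_j g j y *: c j) (\sum_j dg j *: c j).
Proof.
move=> h; rewrite (_ : (fun y => _) = \sum_j (fun y => g j y *: c j)).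
  by apply: is_derive_sum => j; exact: is_derive_scalel.
by apply/funext => y; rewrite fct_sumE.
Qed.

(** Reduces a vector-valued Laplacian to second partial derivatives of real functions. *)
Lemma laplacian_sumZ (V : normedModType R) N (g : 'I_N -> 'rV[R]_n.+1 -> R)
    (g1 g2 : 'I_n.+1 -> 'I_N -> 'rV[R]_n.+1 -> R) (c : 'I_N -> V) x :
  (forall i j y, is_derive y (delta_mx 0 i) (g j) (g1 i j y)) ->
  (forall i j y, is_derive y (delta_mx 0 i) (g1 i j) (g2 i j y)) ->
  laplacian (fun y => \sum_j g j y *: c j) x
  = \sum_j (\sum_i g2 i j x) *: c j.
Proof.
move=> h1 h2; rewrite /laplacian.
under [RHS]eq_bigr do rewrite scaler_suml.
rewrite exchange_big /=; apply: eq_bigr => i _.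
rewrite (_ : 'D__ _ = fun y => \sum_j g1 i j y *: c j); last first.
  by apply/funext => y; exact: (derive_val (is_derive := is_derive_sumZ _ _)).
exact: (derive_val (is_derive := is_derive_sumZ _ _)).
Qed.

Definition sqnorm x : R := \sum_i x 0 i ^+ 2.

(** The coefficient of t^(k-1) in q^-a, where q = 1 - 2 x_0 t + |x|^2 t^2. *)
Definition gegv a k x : R := gegenbauer (x 0 0) (sqnorm x) a k.

Lemma is_derive_sqnorm x i :
  is_derive x (delta_mx 0 i) sqnorm (2 * x 0 i).
Proof.
rewrite (_ : sqnorm = \sum_j (fun y => y 0 j) ^+ 2); last first.
  by apply/funext => y; rewrite fct_sumE.
have h := is_derive_sum (fun j => is_deriveX 2 (is_derive_coord x (delta_mx 0 i) j)).
apply: (is_derive_eq h).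
rewrite (bigD1 i) //= big1 => [|j ji]; rewrite !mxE ?eqxx ?(negPf ji) /GRing.scale /=.
  by rewrite addr0 !mulr1.
by rewrite mulr0.
Qed.

(** Coefficient form of 2 a t (delta_{i0} - x_i t) q^-(a+1), the i-th partial derivative of q^-a. *)
Definition dgegv i a k x : R :=
  2 * a%:R * ((i == 0 :> 'I_n.+1)%:R * gegv a.+1 k.-1 x - x 0 i * gegv a.+1 k.-2 x).

(** Induction on a, then strong induction on k: the recurrence [gegenbauerS] is differentiated term
    by term. *)
Lemma is_derive_gegv x i a k :
  is_derive x (delta_mx 0 i) (gegv a k) (dgegv i a k x).
Proof.
elim: a k => [|a IHa] k.
  rewrite /dgegv mulr0 mul0r; exact: is_derive_cst.
elim/ltn_ind: k => -[_|k IHk].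
  rewrite (_ : gegv _ _ = cst 0); last first.
    by apply/funext => y; rewrite /gegv gegenbauer_0.
  rewrite /dgegv /gegv !gegenbauer_0 !mulr0 subrr mulr0; exact: is_derive_cst.
have h0 := IHa k.+1.
have h1 := IHk k (ltnSn k).
have h2 := IHk k.-1 (leq_ltn_trans (leq_pred k) (ltnSn k)).
have hx := is_derive_coord x (delta_mx 0 i) 0.
have hq := is_derive_sqnorm x i.
rewrite (_ : gegv a.+1 k.+1 = gegv a k.+1 +
  (2 \*: (fun y : 'rV[R]_n.+1 => y 0 0)) * gegv a.+1 k - sqnorm * gegv a.+1 k.-1); last first.
  by apply/funext => y; rewrite /gegv gegenbauerS.
apply: (is_derive_eq (is_deriveB (is_deriveD h0 (is_deriveM (is_deriveZ 2 hx) h1))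
  (is_deriveM hq h2))).
rewrite mxE eqxx /= (eq_sym 0) /dgegv /GRing.scale /gegv /=.
(* The undifferentiated factors of exponent a+1 are rewritten with exponent a+2, the one occurring
   in the derivatives. *)
rewrite (gegenbauer_rec _ _ a.+1 k) (gegenbauer_rec _ _ a.+1 k.-1) -[a.+1%:R]natr1.
ring.
Qed.

Definition ddgegv i a k x : R :=
  2 * a%:R * ((i == 0 :> 'I_n.+1)%:R * dgegv i a.+1 k.-1 x -
    (gegv a.+1 k.-2 x + x 0 i * dgegv i a.+1 k.-2 x)).

Lemma is_derive_dgegv x i a k :
  is_derive x (delta_mx 0 i) (dgegv i a k) (ddgegv i a k x).
Proof.
apply: (is_derive_eq (is_deriveZ (2 * a%:R) (is_derive_subM _ _
  (is_derive_gegv x i a.+1 k.-1) (is_derive_gegv x i a.+1 k.-2)))).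
by rewrite mxE !eqxx /= mul1r.
Qed.

Lemma sum_delta (f : 'I_n.+1 -> R) j : \sum_i (i == j :> 'I_n.+1)%:R * f i = f j.
Proof.
rewrite (bigD1 j) //= eqxx mul1r big1 ?addr0 // => i /negPf ->.
by rewrite mul0r.
Qed.

(** The Laplacian of q^-a is 2 a (2 (a+1) - (n+1)) t^2 q^-(a+1). *)
Lemma sum_ddgegv a k x : \sum_i ddgegv i a k x =
  2 * a%:R * (2 * a.+1%:R - n.+1%:R) * gegv a.+1 k.-2 x.
Proof.
rewrite /ddgegv -mulr_sumr -[RHS]mulrA; congr (_ * _).
rewrite sumrB sum_delta big_split /= sumr_const card_ord -[_ *+ n.+1]mulr_natr.
have -> : \sum_i x 0 i * dgegv i a.+1 k.-2 x = 2 * a.+1%:R *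
    (x 0 0 * gegv a.+2 k.-2.-1 x - sqnorm x * gegv a.+2 k.-2.-2 x).
  have -> : sqnorm x * gegv a.+2 k.-2.-2 x = \sum_i x 0 i ^+ 2 * gegv a.+2 k.-2.-2 x.
    by rewrite mulr_suml.
  rewrite -(sum_delta (fun i => x 0 i * gegv a.+2 k.-2.-1 x) 0) -sumrB mulr_sumr.
  apply: eq_bigr => i _; rewrite /dgegv.
  have [->|/negPf i0] := eqVneq i 0; first by rewrite ?eqxx; ring.
  by rewrite !mulr0n !mul0r !sub0r !mulrN expr2 !mulrA [x 0 i * _]mulrC
    -!mulrA; congr (- (_ * _)); rewrite mulrCA.
(* The terms of exponent a+2 assemble into q q^-(a+2) = q^-(a+1); this is where |grad q|^2 = 4 t^2 q
   enters. *)
rewrite /dgegv eqxx mulr1n mul1r /gegv (gegenbauer_rec _ _ a.+1 k.-2); ring.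
Qed.

(** The j-th coordinate of (1 - \bar x t) q^-a in the basis 1, -e_1, ..., -e_n, in which \bar x has
    coordinates x_j. *)
Definition conj_gegv_coord a k (j : 'I_n.+1) x : R :=
  (j == 0)%:R * gegv a k x - x 0 j * gegv a k.-1 x.

(** Compared with [sum_ddgegv], the cross term -2 t d_j(q^-a) coming from the factor x_j contributes
    an extra -4 a, which turns 2 (a+1) into 2 a. *)
Lemma laplacian_conj_gegv_coord (V : normedModType R) (c : 'I_n.+1 -> V) a k x :
  laplacian (fun y => \sum_j conj_gegv_coord a k j y *: c j) x =
  \sum_j (2 * a%:R * (2 * a%:R - n.+1%:R) * conj_gegv_coord a.+1 k.-2 j x) *: c j.
Proof.
pose g1 (i j : 'I_n.+1) x := (j == 0)%:R * dgegv i a k x -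
   ((j == i)%:R * gegv a k.-1 x + x 0 j * dgegv i a k.-1 x).
pose g2 (i j : 'I_n.+1) x := (j == 0)%:R * ddgegv i a k x -
   ((j == i)%:R * dgegv i a k.-1 x +
    ((j == i)%:R * dgegv i a k.-1 x + x 0 j * ddgegv i a k.-1 x)).
have h1 i j y : is_derive y (delta_mx 0 i) (conj_gegv_coord a k j) (g1 i j y).
  apply: (is_derive_eq (is_derive_subM _ _ (is_derive_gegv _ _ _ _) (is_derive_gegv _ _ _ _))).
  by rewrite mxE eqxx.
have h2 i j y : is_derive y (delta_mx 0 i) (g1 i j) (g2 i j y).
  have d1 := is_derive_dgegv y i a k.
  have d2 := is_derive_dgegv y i a k.-1.
  have d3 := is_derive_gegv y i a k.-1.
  rewrite (_ : g1 i j = ((j == 0)%:R \*: dgegv i a k) -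
     (((j == i)%:R \*: gegv a k.-1) + (fun y : 'rV[R]_n.+1 => y 0 j) * dgegv i a k.-1));
    last exact/funext.
  apply: (is_derive_eq (is_deriveB (is_deriveZ _ d1) (is_deriveD (is_deriveZ _ d3)
    (is_deriveM (is_derive_coord _ _ _) d2)))).
  by rewrite mxE eqxx /= /g2 /GRing.scale /=; ring.
rewrite (laplacian_sumZ c x h1 h2).
apply: eq_bigr => j _; congr (_ *: _).
rewrite /g2 sumrB !big_split /=.
rewrite -[\sum_i (j == 0)%:R * _]mulr_sumr -[\sum_i x 0 j * _]mulr_sumr !sum_ddgegv.
under eq_bigr do rewrite eq_sym.
rewrite sum_delta /conj_gegv_coord /dgegv -[a.+1%:R]natr1; ring.
Qed.

End Laplacian.

(** * Products of two binomial series in commuting elements *)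

Section TwoVariableSeries.
Variables (A : nzRingType) (z w : A).
Hypothesis zw : GRing.comm z w.

(* (a)_s / s!, the coefficient of t^s in (1 - t)^-a; truncation of (a + s).-1
   gives the right value 1 at a = s = 0. *)
Definition neg_bin (a s : nat) : nat := 'C((a + s).-1, s).

Lemma neg_bin0 a : neg_bin a 0 = 1%N.
Proof. by rewrite /neg_bin bin0. Qed.

Lemma neg_bin0S s : neg_bin 0 s.+1 = 0%N.
Proof. by rewrite /neg_bin bin_small. Qed.

Lemma neg_binSS a s : neg_bin a.+1 s.+1 = (neg_bin a s.+1 + neg_bin a.+1 s)%N.
Proof. by rewrite /neg_bin !addSn !addnS binS. Qed.

(* The coefficient of t^(k-1) in (1 - z t)^-a (1 - w t)^-b. *)
Definition binom_series2 a b k : A :=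
  \sum_(s < k) (z ^+ (k.-1 - s) * w ^+ s) *+ (neg_bin a (k.-1 - s) * neg_bin b s).

Lemma binom_series2_0 a b : binom_series2 a b 0 = 0.
Proof. by rewrite /binom_series2 big_ord0. Qed.

(** Multiplication by 1 - z t, through Pascal's rule [neg_binSS]. *)
Lemma binom_series2Sl a b k : binom_series2 a.+1 b k.+1 =
  binom_series2 a b k.+1 + z * binom_series2 a.+1 b k.
Proof.
(* The last term contains z^0, with binomial 1 for both exponents, and is split off. *)
rewrite /binom_series2 !big_ord_recr /= subnn !neg_bin0 -addrA [_ + z * _]addrC addrA.
congr (_ + _); rewrite mulr_sumr -big_split /=; apply: eq_bigr => s _.
have -> : (k - s = (k.-1 - s).+1)%N by have := ltn_ord s; lia.
by rewrite neg_binSS mulnDl mulrnDr exprS !mulrnAr !mulrA.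
Qed.

Lemma binom_series2Sr a b k : binom_series2 a b.+1 k.+1 =
  binom_series2 a b k.+1 + w * binom_series2 a b.+1 k.
Proof.
rewrite /binom_series2 !big_ord_recl /= !neg_bin0 -addrA.
congr (_ + _); rewrite mulr_sumr -big_split /=; apply: eq_bigr => s _.
rewrite /bump /= add1n.
have -> : (k - s.+1 = k.-1 - s)%N by lia.
rewrite neg_binSS mulnDr mulrnDr exprS; congr (_ + _).
rewrite mulrnAr !mulrA; congr (_ * _ *+ _).
(* The new factor w has to pass the power of z. *)
by apply/esym/commrX/commr_sym.
Qed.

Lemma binom_series2_1_0 k : binom_series2 1 0 k.+1 = z ^+ k.
Proof.
rewrite /binom_series2 big_ord_recl big1 /= => [|s _]; last first.
  by rewrite neg_bin0S muln0.
by rewrite addr0 subn0 neg_bin0 muln1 mulr1 /neg_bin add1n /= binn.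
Qed.

(** Multiplication by (1 - z t)(1 - w t); [conj_gegvS] has the same shape. *)
Lemma binom_series2SS a b k : binom_series2 a.+1 b.+1 k.+1 =
  binom_series2 a b k.+1 + (z + w) * binom_series2 a.+1 b.+1 k
  - w * z * binom_series2 a.+1 b.+1 k.-1.
Proof.
rewrite binom_series2Sl binom_series2Sr.
have -> : binom_series2 a b.+1 k =
    binom_series2 a.+1 b.+1 k - z * binom_series2 a.+1 b.+1 k.-1.
  by case: k => [|k]; rewrite ?binom_series2_0 ?mulr0 ?subr0 // binom_series2Sl addrK.
rewrite mulrBr mulrDl mulrA -!addrA; congr (_ + _).
by rewrite [RHS]addrCA; congr (_ + _); rewrite addrC.
Qed.

End TwoVariableSeries.

(** * Paravectors and the generating series of their powers *)

Section Paravector.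
Variables (R : realType) (n : nat).
Implicit Types (x : 'rV[R]_n.+1).
Local Notation pv := (@paravector R n).
Local Notation pvc := (@paravector_conj R n).

Definition cl_vector x : clifford R n := \sum_(l < n) x 0 (lift ord0 l) *: cl_gen R l.

(** Adding the double sum to its transpose cancels the off-diagonal terms by anticommutation; the
    result is then halved. *)
Lemma cl_vector_sqr x :
  cl_vector x * cl_vector x = - (\sum_(l < n) x 0 (lift ord0 l) ^+ 2)%:A.
Proof.
pose a l := x 0 (lift ord0 l).
pose S := \sum_l \sum_m (a l * a m) *: (cl_gen R l * cl_gen R m).
have SE : cl_vector x * cl_vector x = S.
  rewrite /cl_vector mulr_suml; apply: eq_bigr => l _.
  rewrite mulr_sumr; apply: eq_bigr => m _.
  by rewrite -scalerAr -scalerAl scalerA mulrC.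
have S2 : S + S = (- (\sum_l a l ^+ 2)%:A) *+ 2.
  rewrite {2}/S exchange_big -big_split /=.
  rewrite -scaleNr -sumrN scaler_suml -sumrMnl; apply: eq_bigr => l _.
  rewrite -big_split (bigD1 l) //= big1 ?addr0 => [|m ml].
    by rewrite -[cl_gen R l * _]expr2 cl_gen_sqr scalerN scaleNr mulr2n.
  by rewrite [a m * _]mulrC -scalerDr cl_gen_anticomm ?scaler0 // eq_sym.
rewrite SE -/(a _); apply: (@scalerI _ _ (2 : R)); first by rewrite pnatr_eq0.
by rewrite !scaler_nat mulr2n S2.
Qed.

Lemma paravectorD x : pv x + pvc x = (2 * x 0 0)%:A.
Proof. by rewrite /paravector /paravector_conj addrACA subrr addr0 -scalerDl mulrDl mul1r. Qed.

Lemma scalar_comm (a : R) (u : clifford R n) : a%:A * u = u * a%:A.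
Proof. by rewrite mulr_algl mulr_algr. Qed.

Lemma paravector_conjM x : pvc x * pv x = (sqnorm x)%:A.
Proof.
rewrite /paravector /paravector_conj -/(cl_vector x) mulrBl !mulrDr cl_vector_sqr.
rewrite -(scalar_comm _ (cl_vector x)) opprD addrA addrK opprK.
by rewrite mulr_algl scalerA -expr2 -scalerDl /sqnorm big_ord_recl.
Qed.

(** \bar x = 2 x_0 - x is a polynomial in x with real coefficients. *)
Lemma paravector_comm x : GRing.comm (pv x) (pvc x).
Proof.
rewrite /GRing.comm.
have -> : pvc x = (2 * x 0 0)%:A - pv x by rewrite -paravectorD addrAC subrr add0r.
by rewrite mulrBr mulrBl mulr_algl mulr_algr.
Qed.

Definition conj_unit (j : 'I_n.+1) : clifford R n := pvc (delta_mx 0 j).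

Lemma conj_unit0 : conj_unit 0 = 1.
Proof.
rewrite /conj_unit /paravector_conj mxE !eqxx big1 ?subr0 ?scale1r // => l _.
by rewrite mxE /= scale0r.
Qed.

Lemma conj_unitS l : conj_unit (lift ord0 l) = - cl_gen R l.
Proof.
rewrite /conj_unit /paravector_conj mxE /= scale0r sub0r; congr (- _).
rewrite (bigD1 l) //= big1 => [|m ml]; first by rewrite addr0 mxE !eqxx scale1r.
by rewrite mxE (inj_eq lift_inj) (negPf ml) andbF scale0r.
Qed.

Lemma paravector_conjE x : pvc x = \sum_j x 0 j *: conj_unit j.
Proof.
rewrite big_ord_recl conj_unit0 /paravector_conj -sumrN; congr (_ + _).
by apply: eq_bigr => l _; rewrite conj_unitS scalerN.
Qed.

(* The coefficient of t^(k-1) in (1 - \bar x t) q^-a. *)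
Definition conj_gegv a k x : clifford R n :=
  gegv a k x *: 1 - gegv a k.-1 x *: pvc x.

Lemma conj_gegvE a k x : conj_gegv a k x = \sum_j conj_gegv_coord a k j x *: conj_unit j.
Proof.
rewrite /conj_gegv -conj_unit0 paravector_conjE.
under [RHS]eq_bigr do rewrite /conj_gegv_coord scalerBl.
rewrite sumrB; congr (_ - _).
  rewrite (bigD1 ord0) //= big1 ?addr0 ?mul1r // => j /negPf ->.
  by rewrite mul0r scale0r.
by rewrite scaler_sumr; apply: eq_bigr => j _; rewrite scalerA mulrC.
Qed.

(** The scalar b is absorbed into the constant vectors, so iteration needs no separate linearity of
    [laplacian]. *)
Lemma laplacian_conj_gegv (b : R) a k x :
  laplacian (fun y => b *: conj_gegv a k y) x =
  (b * (2 * a%:R * (2 * a%:R - n.+1%:R))) *: conj_gegv a.+1 k.-2 x.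
Proof.
rewrite (_ : (fun y => _) = fun y => \sum_j conj_gegv_coord a k j y *: (b *: conj_unit j)).
  rewrite laplacian_conj_gegv_coord conj_gegvE scaler_sumr; apply: eq_bigr => j _.
  by rewrite !scalerA; congr (_ *: _); ring.
apply/funext => y; rewrite conj_gegvE scaler_sumr; apply: eq_bigr => j _.
by rewrite !scalerA mulrC.
Qed.

Lemma iter_laplacian_conj_gegv i k x :
  iter i (@laplacian R n (clifford R n)) (conj_gegv 1 k) x =
  (\prod_(j < i) (2 * j.+1%:R * (2 * j.+1%:R - n.+1%:R))) *: conj_gegv i.+1 (k - i.*2) x.
Proof.
elim: i x => [|i IHi] x; first by rewrite big_ord0 scale1r subn0.
rewrite iterS (funext IHi).
by rewrite laplacian_conj_gegv big_ord_recr /= doubleS -!subn2 -subnDA addn2.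
Qed.

Lemma conj_gegv_0 a x : conj_gegv a 0 x = 0.
Proof. by rewrite /conj_gegv /gegv !gegenbauer_0 !scale0r subrr. Qed.

(** Multiplication by q = 1 - (x + \bar x) t + \bar x x t^2. *)
Lemma conj_gegvS a k x : conj_gegv a.+1 k.+1 x =
  conj_gegv a k.+1 x + (pv x + pvc x) * conj_gegv a.+1 k x
  - pvc x * pv x * conj_gegv a.+1 k.-1 x.
Proof.
rewrite paravectorD paravector_conjM !mulr_algl /conj_gegv /gegv gegenbauerS.
rewrite (gegenbauer_rec _ _ a k) /= !scalerBr !scalerA.
(* What remains is linear in the vectors with real coefficients, so it can be checked
   coordinatewise. *)
move: (gegenbauer _ _) => g; move: (x 0 0) (sqnorm x) (pvc x) (1 : clifford R n) => p q z e.
apply/(@rowP R #|{set 'I_n}|) => i; rewrite !mxE; ring.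
Qed.

(** Geometric series: (1 - \bar x t) q^-1 = (1 - x t)^-1. *)
Lemma conj_gegv_1 k x : conj_gegv 1 k.+1 x = pv x ^+ k.
Proof.
elim: k => [|k IHk].
  by rewrite /conj_gegv /gegv gegenbauerS !gegenbauer_0 !mulr0 subr0 addr0 scale1r scale0r subr0.
(* q^0 = 1 has no term in t^(k+1). *)
rewrite exprS -IHk /conj_gegv /gegv gegenbauerS (_ : gegenbauer _ _ 0 k.+2 = 0) // add0r /=.
set g1 := gegenbauer _ _ _ k.+1; set g0 := gegenbauer _ _ _ k.
rewrite [pv x * _]mulrBr -!scalerAr mulr1 paravector_comm paravector_conjM scalerA.
rewrite scalerBl (mulrC _ g0) (mulrC _ g1) -[(g1 * _) *: 1]scalerA -paravectorD.
by rewrite scalerDr addrAC addrK.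
Qed.

(** Both sides satisfy the same recurrence, and at a = 0 both give the powers of x. *)
Lemma conj_gegv_binom_series2 a k x :
  conj_gegv a.+1 k x = binom_series2 (pv x) (pvc x) a.+1 a k.
Proof.
elim: a k => [|a IHa] k.
  by case: k => [|k]; rewrite ?conj_gegv_0 ?binom_series2_0 // conj_gegv_1 binom_series2_1_0.
elim/ltn_ind: k => -[_|k IHk]; first by rewrite conj_gegv_0 binom_series2_0.
rewrite conj_gegvS binom_series2SS; last exact: paravector_comm.
by rewrite IHa !IHk // (leq_ltn_trans (leq_pred k)).
Qed.

End Paravector.

(** * Matching the constants, and the final identity *)

Lemma pochhammer_neg_bin (R : realType) (a s : nat) :
  pochhammer (a%:R : R) s = (neg_bin a s * s`!)%:R.
Proof.
elim: s => [|s IHs]; first by rewrite /pochhammer big_ord0 neg_bin0.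
rewrite /pochhammer big_ord_recr /= -/(pochhammer _ _) IHs -natrD -natrM; congr _%:R.
rewrite factS mulnA [(neg_bin a s.+1 * _)%N]mulnC /neg_bin addnS -mul_bin_diag /=.
by rewrite mulnC mulnA.
Qed.

Lemma half_natr (R : realType) (m : nat) : m.*2%:R / 2 = m%:R :> R.
Proof. by rewrite -muln2 natrM mulfK // pnatr_eq0. Qed.

(** For n = 2m+1 the Pochhammer parameters are the integers m+1, m and 2m+1, so all three symbols
    become binomials times factorials. *)
Lemma appell_coefE (R : realType) (m k s : nat) : (s <= k)%N ->
  appell_coef R m.*2.+1 k s =
  k`!%:R * (m.*2)`!%:R / (m.*2 + k)`!%:R * (neg_bin m.+1 (k - s) * neg_bin m s)%:R.
Proof.
move=> sk; rewrite /appell_coef.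
rewrite (half_natr R m.+1).
have -> : (m.*2.+1%:R - 1) / 2 = m%:R :> R.
  by rewrite -natr1 addrK half_natr.
rewrite !pochhammer_neg_bin {3}/neg_bin addSn /=.
have f0 j : j`!%:R != 0 :> R by rewrite pnatr_eq0 -lt0n fact_gt0.
have kE : k`!%:R = 'C(k, s)%:R * s`!%:R * (k - s)`!%:R :> R.
  by rewrite -!natrM -mulnA bin_fact.
have nE : (m.*2 + k)`!%:R = 'C(m.*2 + k, k)%:R * k`!%:R * (m.*2)`!%:R :> R.
  by rewrite -!natrM -mulnA -[in LHS](bin_fact (leq_addl m.*2 k)) addnK.
have c0 : 'C(m.*2 + k, k)%:R != 0 :> R by rewrite pnatr_eq0 -lt0n bin_gt0 leq_addl.
have c1 : 'C(k, s)%:R != 0 :> R by rewrite pnatr_eq0 -lt0n bin_gt0.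
by rewrite nE !natrM kE; field; rewrite c0 c1 !f0.
Qed.

Lemma gamma_coefE (R : realType) (m : nat) :
  gamma_coef R m.*2.+1 = (-1) ^+ m * 2 ^+ m.*2 / (m.*2)`!%:R * m`!%:R ^+ 2.
Proof.
by rewrite /gamma_coef subn1 /= divn2 doubleK (half_natr R m.+1) Gamma_succ.
Qed.

(** With a = j+1 each factor is -4 a (m+1-a), and m+1-a runs through 1, ..., m in reverse. *)
Lemma prod_laplacian_coef (R : realType) (m : nat) :
  \prod_(j < m) (2 * j.+1%:R * (2 * j.+1%:R - m.*2.+2%:R)) =
  (-1) ^+ m * 2 ^+ m.*2 * m`!%:R ^+ 2 :> R.
Proof.
have factE : \prod_(j < m) j.+1%:R = m`!%:R :> R.
  by rewrite -natr_prod; congr _%:R; rewrite fact_prod big_add1 big_mkord.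
have revE : \prod_(j < m) (rev_ord j).+1%:R = m`!%:R :> R.
  by rewrite -factE [RHS](reindex_inj rev_ord_inj).
rewrite (eq_bigr (fun j : 'I_m => -1 * 2 ^+ 2 * (j.+1%:R * (rev_ord j).+1%:R))).
  rewrite big_split prodr_const card_ord /= exprMn -exprM mul2n; congr (_ * _).
  by rewrite big_split /= factE revE expr2.
move=> j _; rewrite /= subnSK // natrB 1?ltnW // -doubleS -mul2n natrM.
by rewrite -[m.+1%:R]natr1 -[j.+1%:R]natr1; ring.
Qed.

Theorem theorem3p1 (R : realType) (n k : nat) (n_ge1 : (1 <= n)%N)
    (n_odd : odd n) (x : 'rV[R]_n.+1) :
  iter ((n - 1) %/ 2) (@laplacian R n (clifford R n))
    (fun y : 'rV[R]_n.+1 => paravector y ^+ (n + k - 1)) x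
  = (gamma_coef R n * ((n + k - 1)`!%:R / k`!%:R)) *: appell k x.
Proof.
have [m nE] : exists m, n = m.*2.+1.
  by exists n./2; rewrite -[LHS]odd_double_half n_odd.
rewrite {}nE in x n_ge1 n_odd *.
have -> : ((m.*2.+1 - 1) %/ 2 = m)%N by rewrite subn1 /= -muln2 mulnK.
have -> : (m.*2.+1 + k - 1 = m.*2 + k)%N by rewrite addSn subn1.
(* The index is one more than the exponent, as index k stands for t^(k-1). *)
rewrite (_ : (fun y => _) = @conj_gegv R m.*2.+1 1 (m.*2 + k).+1); last first.
  by apply/funext => y; rewrite conj_gegv_1.
rewrite iter_laplacian_conj_gegv prod_laplacian_coef conj_gegv_binom_series2.
(* The m steps lower the index to k+1, so both sums run over s <= k and are compared term by
   term. *)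
rewrite -addnS addKn /binom_series2 /appell !scaler_sumr; apply: eq_bigr => s _.
rewrite appell_coefE; last by rewrite -ltnS.
rewrite -[k.+1.-1]/k -[_ *+ (neg_bin _ _ * _)]scaler_nat !scalerA; congr (_ *: _).
rewrite gamma_coefE.
have f0 j : j`!%:R != 0 :> R by rewrite pnatr_eq0 -lt0n fact_gt0.
by field; rewrite !f0.
Qed.
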